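(* Let $n\ge 1$. The juggling map $$\sigma\colon \mathbf{Barc}(n)\to \mathbf{JS}(\leq n+1,\langle 0\rangle,n),\qquad \sigma(B)=\big(\langle\delta(B^0)\rangle,\langle\delta(B^1)\rangle,\dots,\langle\delta(B^n)\rangle\big),\quad B^i=\tau_i(B),$$ is well defined (i.e. $\sigma(B)$ lies in the stated codomain for every $B$) and is a bijection. Moreover, for every Betti curve $\beta=(\beta_1,\dots,\beta_n)$ of length $n$, $\sigma$ restricts to a bijection $$\sigma_\beta\colon \mathbf{Barc}(\beta)\to\mathbf{JS}(\langle\delta(\beta)\rangle,\langle 0\rangle,n).$$
   Context: Barcodes. Write $[n]=\{1,\dots,n\}$. For integers $i\le j$, $[i,j)$ denotes $\{i,\dots,j-1\}$; nonempty sets of this form are called intervals (or bars). A Betti curve of length $n$ is a function $\beta\colon[n]\to\mathbb{Z}_{\ge0}$, written $(\beta_1,\dots,\beta_n)$. A barcode is a (finite) multiset of intervals; $\mathbf{Barc}(n)$ is the set of barcodes all of whose intervals are subsets of $[n]$. The Betti curve $\varphi(B)$ of $B\in\mathbf{Barc}(n)$ sends $i\in[n]$ to the number of intervals of $B$, counted with multiplicity, containing $i$. For a Betti curve $\beta$ of length $n$, $\mathbf{Barc}(\beta)=\varphi^{-1}(\beta)$. The differential of a Betti curve $\beta$ of length $n$ is the integer sequence of length $n+1$ given by $\delta(\beta)=(\beta_1,\beta_2-\beta_1,\dots,\beta_n-\beta_{n-1},-\beta_n)$. For $B\in\mathbf{Barc}(n)$, write $\delta(B)=\delta(\varphi(B))$.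 For an integer $i\ge0$, the $i$-truncation $\tau_i(B)$ of a barcode $B$ is the barcode having a bar $[a-i,b-i)$ for every bar $[a,b)$ of $B$ (with multiplicity) with $a\ge i+1$. If $B\in\mathbf{Barc}(n)$ then $\tau_i(B)$ is regarded as an element of $\mathbf{Barc}(n)$. Juggling. $\langle s_1,\dots,s_h\rangle$ denotes the infinite zero-padded sequence $(s_1,\dots,s_h,0,0,\dots)$; for a finite sequence $x$, $\langle x\rangle$ is its zero-padding. A juggling state is a sequence $\mathbf{s}=\langle s_1,\dots,s_h\rangle$ with $s_i\in\mathbb{Z}$ and $\sum_j s_j\ge0$. A valid transition from a state $\langle s_1,s_2,\dots,s_h\rangle$ to a state $\mathbf{s}'$ occurs when there are non-negative integers $t_1,\dots,t_{h'}$ with $\sum_{j=1}^{h'}t_j=s_1$ such that $\mathbf{s}'=\langle s_2+t_1,s_3+t_2,\dots,s_h+t_{h-1},t_h,\dots,t_{h'}\rangle$ (i.e. the $k$-th entry of $\mathbf{s}'$ is $s_{k+1}+t_k$ for all $k\ge1$, where $s_k=0$ for $k>h$ and $t_k=0$ for $k>h'$). A magic juggling sequence of length $n$ is an ordered list $(\mathbf{s}^0,\mathbf{s}^1,\dots,\mathbf{s}^n)$ of juggling states with a valid transition from $\mathbf{s}^{i-1}$ to $\mathbf{s}^i$ for each $1\le i\le n$. $\mathbf{JS}(\mathbf{a},\mathbf{b},n)$ is the set of magic juggling sequences of length $n$ with $\mathbf{s}^0=\mathbf{a}$ and $\mathbf{s}^n=\mathbf{b}$. $\mathbf{JS}(\le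 h,\mathbf{b},n)$ is the set of magic juggling sequences of length $n$ with $\mathbf{s}^n=\mathbf{b}$ and whose initial state $\mathbf{s}^0$ is of the form $\langle s_1,\dots,s_h\rangle$, i.e. is zero after the first $h$ entries. $\langle 0\rangle$ is the zero state. *)

(* Defs.v *)
From HB Require Import structures.
From mathcomp Require Import all_boot all_order all_algebra.
From mathcomp Require Import finmap multiset.
From mathcomp Require Import classical_sets functions.

Set Implicit Arguments.
Unset Strict Implicit.
Unset Printing Implicit Defensive.

Import Order.TTheory GRing.Theory Num.Theory.

Local Open Scope classical_set_scope.
Local Open Scope mset_scope.
Local Open Scope ring_scope.

(* A nonempty [a, b) determines its endpoints, so a bar is encoded by them. *)
Record bar := Bar { bounds : int * int; boundsP : bounds.1 < bounds.2 }.

HB.instance Definition _ := [isSub for bounds].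
HB.instance Definition _ := [Choice of bar by <:].

Definition bar_itv (I : bar) : interval int := `[(bounds I).1, (bounds I).2[.

Notation barcode := {mset bar}.

Definition Barc (n : nat) : set barcode :=
  [set B : barcode | forall I : bar, I \in B -> {subset bar_itv I <= `[1, n%:Z]}].

(* Betti curves, differentials, juggling states and throws, whose entries are
   indexed from 1 in the mathematics, store entry k at position k - 1; the
   states s^0, ..., s^n of a juggling sequence keep their indices. *)

Definition betti_curve (n : nat) := n.-tuple nat.

(* [count] runs over the enumeration of the multiset, in which every bar is
   repeated according to its multiplicity. *)
Definition betti (n : nat) (B : barcode) : betti_curve n :=
  [tuple count (fun I => i.+1%:Z \in bar_itv I) B | i < n].

Definition BarcB (n : nat) (beta : betti_curve n) : set barcode :=
  Barc n `&` [set B : barcode | betti n B = beta].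

(* The k-th entry is beta_k - beta_(k-1), where beta_0 = beta_(n+1) = 0: these
   two values are the head of [0 :: beta] and the default of [nth]. *)
Definition diff (n : nat) (beta : betti_curve n) : n.+1.-tuple int :=
  [tuple (nth 0%N beta k)%:Z - (nth 0%N (0%N :: beta) k)%:Z | k < n.+1].

Fact shift_barP (i : nat) (I : bar) :
  (bounds I).1 - i%:Z < (bounds I).2 - i%:Z.
Proof. by rewrite ltrD2r (boundsP I). Qed.

Definition shift_bar (i : nat) (I : bar) : bar :=
  @Bar ((bounds I).1 - i%:Z, (bounds I).2 - i%:Z) (shift_barP i I).

Definition trunc (i : nat) (B : barcode) : barcode :=
  seq_mset (map (shift_bar i) (filter (fun I => i.+1%:Z <= (bounds I).1) B)).

Definition zseq := nat -> int.

Definition pad (s : seq int) : zseq := fun k => nth 0 s k.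

Definition zero_state : zseq := pad [:: 0].

Definition juggling_state (s : zseq) : Prop :=
  exists l : seq int, s = pad l /\ 0 <= \sum_(x <- l) x.

Definition valid_transition (s s' : zseq) : Prop :=
  exists t : seq nat,
    (sumn t)%:Z = s 0%N /\ forall k, s' k = s k.+1 + (nth 0%N t k)%:Z.

Definition magic_juggling_sequence (n : nat) (S : n.+1.-tuple zseq) : Prop :=
  (forall i : 'I_n.+1, juggling_state (tnth S i)) /\
  (forall i : 'I_n, valid_transition (tnth S (widen_ord (leqnSn n) i))
                                     (tnth S (lift ord0 i))).

Definition JS (a b : zseq) (n : nat) : set (n.+1.-tuple zseq) :=
  [set S | [/\ magic_juggling_sequence S,
               tnth S ord0 = a & tnth S ord_max = b]].

Definition JSle (h : nat) (b : zseq) (n : nat) : set (n.+1.-tuple zseq) :=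
  [set S | [/\ magic_juggling_sequence S,
               exists l : h.-tuple int, tnth S ord0 = pad l
             & tnth S ord_max = b]].

Definition juggling_map (n : nat) (B : barcode) : n.+1.-tuple zseq :=
  [tuple pad (diff (betti n (trunc i B))) | i < n.+1].

(* Main.v *)
(* The bars of B born at i + 1 are exactly the throws at time i: passing from
   tau_i(B) to tau_(i+1)(B) deletes the bars [i + 1, b), and this adds 1 to the
   entry of the differential at each of their ends b. Hence the throws, that is
   the multiplicities of B, are read off consecutive states, which gives
   injectivity. Conversely, the throws of a juggling sequence define a barcode;
   as the last state is zero and the first has at most n + 1 entries, every
   throw lands by time n, so all the bars lie in [n], and the states agree by
   backward induction from the zero state. *)
From HB Require Import structures.
Require Import Defs.
From mathcomp Require Import all_boot all_order all_algebra.
From mathcomp Require Import finmap multiset.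
From mathcomp Require Import boolp classical_sets functions.
From mathcomp Require Import zify.

Set Implicit Arguments.
Unset Strict Implicit.
Unset Printing Implicit Defensive.

Import Order.TTheory GRing.Theory Num.Theory.

Local Open Scope classical_set_scope.
Local Open Scope ring_scope.

(** * Births, deaths and bars as throws *)

Definition dim_at (p : nat) (B : barcode) : nat :=
  count (fun I => p%:Z \in bar_itv I) B.
Definition births (p : nat) (B : barcode) : nat :=
  count (fun I => (bounds I).1 == p%:Z) B.
Definition deaths (p : nat) (B : barcode) : nat :=
  count (fun I => (bounds I).2 == p%:Z) B.
(** Counts the bars dying at [p] that survive truncation at [i], in the coordinates of [B] before
    the shift. *)
Definition late_deaths (i p : nat) (B : barcode) : nat :=
  count (fun I => ((bounds I).2 == p%:Z) && (i.+1%:Z <= (bounds I).1)) B.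

Fact throw_barP (i k : nat) :
  (i.+1%:Z, (i + k).+2%:Z).1 < (i.+1%:Z, (i + k).+2%:Z).2.
Proof. by rewrite /=; lia. Qed.

(* The throw from time [i] landing at entry [k] corresponds to the bar
   [i + 1, i + k + 2): entries are stored with an offset of one. *)
Definition throw_bar (i k : nat) : bar := Bar (throw_barP i k).

Lemma mem_Barc (n : nat) (B : barcode) :
  Barc n B <-> forall I, I \in B -> 1 <= (bounds I).1 /\ (bounds I).2 <= n.+1%:Z.
Proof.
split=> BP I IB; last first.
  by move=> p; rewrite !in_itv /=; have := BP I IB; lia.
have IP := boundsP I.
(* A bar is nonempty, so the inclusion can be tested at its first and last points. *)
have := BP I IB (bounds I).1; have := BP I IB ((bounds I).2 - 1).
rewrite !in_itv /=; lia.
Qed.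

Lemma throw_bar_surj (n : nat) (I : bar) :
  1 <= (bounds I).1 -> (bounds I).2 <= n.+1%:Z ->
  exists2 i, (i < n)%N & exists k, I = throw_bar i k.
Proof.
have IP := boundsP I => a1 bn.
exists (absz (bounds I).1).-1; first by lia.
exists (absz ((bounds I).2 - (bounds I).1)).-1.
apply: val_inj => /=; case: (bounds I) IP a1 bn => a b /= *.
by congr pair; lia.
Qed.

Lemma Barc_throw_bar0 (n i k : nat) (B : barcode) :
  Barc n B -> (n <= i + k)%N -> B (throw_bar i k) = 0%N.
Proof.
move=> /mem_Barc BP nik; apply/eqP; rewrite mset_eq0; apply/negP => /BP /=; lia.
Qed.

Lemma Barc_out (n : nat) (B : barcode) (P : pred bar) :
  Barc n B -> (forall I, 1 <= (bounds I).1 -> (bounds I).2 <= n.+1%:Z -> ~~ P I) ->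
  count P B = 0%N.
Proof.
move=> /mem_Barc BP PN; apply/eqP; rewrite -leqn0 leqNgt -has_count.
by apply/hasPn => I /BP[]; exact: PN.
Qed.

(** * The differential as births minus deaths *)

(** Bar by bar: the indicator of [a, b) jumps by +1 at a and by -1 at b, and a < b keeps the two
    apart. *)
Lemma dim_atS (p : nat) (B : barcode) :
  (dim_at p.+1 B)%:Z - (dim_at p B)%:Z = (births p.+1 B)%:Z - (deaths p.+1 B)%:Z.
Proof.
rewrite /dim_at /births /deaths.
elim: (B : seq bar) => //= I s IHs; rewrite !in_itv /=.
by have := boundsP I; lia.
Qed.

Lemma nth_betti (n k : nat) (B : barcode) :
  Barc n B -> nth 0%N (betti n B) k = dim_at k.+1 B.
Proof.
move=> BP; have [kn|nk] := ltnP k n.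
  by rewrite -[k]/(val (Ordinal kn)) -tnth_nth tnth_mktuple.
rewrite nth_default ?size_tuple // /dim_at (Barc_out BP) //.
by move=> I; rewrite in_itv /=; lia.
Qed.

Lemma pad_diff (n : nat) (B : barcode) (k : nat) :
  Barc n B -> pad (diff (betti n B)) k = (births k.+1 B)%:Z - (deaths k.+1 B)%:Z.
Proof.
move=> BP; rewrite -dim_atS /pad.
have d0 : dim_at 0 B = 0%N.
  by rewrite /dim_at (Barc_out BP) // => I; rewrite in_itv /=; lia.
have nth0b j : nth 0%N (0%N :: betti n B) j = dim_at j B.
  by case: j => [|j] /=; rewrite ?d0 // nth_betti.
have [kn|nk] := ltnP k n.+1.
  rewrite -[k in LHS]/(val (Ordinal kn)) -tnth_nth tnth_mktuple.
  by rewrite nth0b nth_betti.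
rewrite -(nth_betti k BP) -(nth0b k) !nth_default ?size_tuple //=.
exact: ltnW.
Qed.

(** * Truncation and the entries of the states *)

Lemma count_trunc (P : pred bar) (i : nat) (B : barcode) :
  count P (trunc i B) =
  count (fun I => P (shift_bar i I) && (i.+1%:Z <= (bounds I).1)) B.
Proof. by rewrite (permP (perm_eq_seq_mset _)) count_map count_filter. Qed.

Lemma trunc_Barc (n i : nat) (B : barcode) : Barc n B -> Barc n (trunc i B).
Proof.
move=> /mem_Barc BP; apply/mem_Barc => I.
rewrite (perm_mem (perm_eq_seq_mset _)) => /mapP[J].
by rewrite mem_filter => /andP[iJ /BP[]] ? ? -> /=; lia.
Qed.

Lemma trunc0 (n : nat) (B : barcode) : Barc n B -> trunc 0 B = B.
Proof.
move=> /mem_Barc BP; rewrite -[RHS]seq_mset_id /trunc.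
congr seq_mset; rewrite (_ : [seq I <- B | _] = B).
  rewrite -[RHS]map_id; apply: eq_map => I; apply: val_inj => /=.
  by rewrite !subr0; case: (bounds I).
by apply/all_filterP/allP => I /BP[].
Qed.

(** Entry [k] of state [i] looks at position [i + k + 1] of [B]. A bar born there survives
    truncation automatically, so only the deaths carry the condition. *)
Lemma juggling_mapE (n : nat) (i : 'I_n.+1) (B : barcode) (k : nat) : Barc n B ->
  tnth (juggling_map n B) i k =
  (births (i + k).+1 B)%:Z - (late_deaths i (i + k).+1 B)%:Z.
Proof.
move=> BP; rewrite tnth_mktuple pad_diff; last exact: trunc_Barc.
by rewrite /births /deaths !count_trunc; congr (_%:Z - _%:Z);
   apply: eq_count => I /=; lia.
Qed.

(** Both states look at position [i + k + 2]. The deaths there counted by [late_deaths i] but not by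
    [late_deaths i.+1] are those of bars born at [i + 1], the copies of [throw_bar i k]. *)
Lemma juggling_mapS (n : nat) (i : 'I_n) (B : barcode) (k : nat) : Barc n B ->
  tnth (juggling_map n B) (lift ord0 i) k =
  tnth (juggling_map n B) (widen_ord (leqnSn n) i) k.+1 + (B (throw_bar i k))%:Z.
Proof.
move=> BP; rewrite !juggling_mapE //= /bump leq0n add1n addSn addnS.
rewrite -count_mem_mset /births /late_deaths.
elim: (B : seq bar) => //= I s IHs.
have -> : (I == throw_bar i k) =
    ((bounds I).1 == i.+1%:Z) && ((bounds I).2 == (i + k).+2%:Z).
  by rewrite -val_eqE.
by lia.
Qed.

Lemma juggling_map_head (n : nat) (i : 'I_n) (B : barcode) : Barc n B ->
  tnth (juggling_map n B) (widen_ord (leqnSn n) i) 0 =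
  (\sum_(k < n) B (throw_bar i k))%:Z.
Proof.
move=> BP; rewrite juggling_mapE //= addn0.
(* A surviving bar starts at [i + 1] or later, so it cannot end at [i + 1]. *)
have -> : late_deaths i i.+1 B = 0%N.
  by rewrite /late_deaths (Barc_out BP) // => I; have := boundsP I; lia.
rewrite subr0 /births -sum1_count big_mkcond; congr _%:Z.
under [RHS]eq_bigr do rewrite -count_mem_mset -sum1_count big_mkcond.
(* After the exchange, a bar born at [i + 1] equals [throw_bar i k] for exactly one [k < n], and any
   other bar for none. *)
rewrite exchange_big /=; apply: eq_big_seq => I IB.
have [a1 bn] := (mem_Barc n B).1 BP I IB.
have [aE|aN] := eqVneq; last first.
  rewrite big1 // => k _; case: eqP => // Ik.
  by rewrite Ik eqxx in aN.
have [j jn [k Ik]] := throw_bar_surj a1 bn.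
have kn : (k < n)%N by move: bn; rewrite Ik /=; lia.
rewrite (bigD1 (Ordinal kn)) //= big1 ?addn0 => [|l lk].
  by rewrite Ik; rewrite Ik /= in aE; case: aE => ->; rewrite eqxx.
case: eqP => // Il; case/negP: lk; apply/eqP/val_inj => /=.
by move: Ik; rewrite Il => -[] /=; lia.
Qed.

(** * Padded sequences and differentials *)

Lemma zero_stateE (k : nat) : zero_state k = 0.
Proof. by case: k => [|[|k]]. Qed.

Lemma pad_inj (m : nat) : injective (fun s : m.-tuple int => pad s).
Proof.
move=> s t st; apply: eq_from_tnth => i.
by rewrite !(tnth_nth 0); exact: (congr1 (fun f : zseq => f i) st).
Qed.

Lemma diff_inj (n : nat) : injective (@diff n).
Proof.
move=> b c bc.
have bcE (k : nat) : nth 0%N b k = nth 0%N c k.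
  have [nk|kn] := leqP n k; first by rewrite !nth_default ?size_tuple.
  elim: k kn => [|k IHk] kn.
    by have := congr1 (fun s => tnth s (Ordinal (ltnW kn : 0 < n.+1)%N)) bc;
       rewrite !tnth_mktuple /=; lia.
  have := congr1 (fun s => tnth s (Ordinal (ltnW kn : k.+1 < n.+1)%N)) bc.
  by rewrite !tnth_mktuple /= IHk 1?ltnW //; lia.
by apply: eq_from_tnth => i; rewrite !(tnth_nth 0%N).
Qed.

(** Telescopes from beta_0 = 0 to beta_(n+1) = 0, so the states of the juggling map meet the sign
    condition with equality. *)
Lemma sum_diff (n : nat) (beta : betti_curve n) : \sum_(x <- diff beta) x = 0.
Proof.
rewrite big_tuple; under eq_bigr do rewrite tnth_mktuple.
rewrite -(big_mkord xpredT (fun k => (nth 0%N (0%N :: beta) k.+1)%:Z -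
                                     (nth 0%N (0%N :: beta) k)%:Z)) /=.
rewrite (telescope_sumr (fun k => (nth 0%N (0%N :: beta) k)%:Z)) //=.
by rewrite nth_default ?size_tuple // subrr.
Qed.

(** * Well-definedness and injectivity *)

(** The last state only counts bars born after [n], and [Barc n] has none. *)
Lemma juggling_map_last (n : nat) (B : barcode) : Barc n B ->
  tnth (juggling_map n B) ord_max = zero_state.
Proof.
move=> BP; apply: funext => k; rewrite juggling_mapE //= zero_stateE.
rewrite /births /late_deaths !(Barc_out BP) // => I;
  by have := boundsP I; lia.
Qed.

Lemma juggling_map_inj (n : nat) : set_inj (Barc n) (juggling_map n).
Proof.
move=> B C; rewrite !inE => BP CP BC; apply/msetP => I.
have [/andP[a1 bn]|IN] :=
  boolP ((1 <= (bounds I).1) && ((bounds I).2 <= n.+1%:Z)).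
  have [i i_n [k ->]] := throw_bar_surj a1 bn.
  have := juggling_mapS (Ordinal i_n) k BP.
  by rewrite BC juggling_mapS //= => /addrI[].
have out D : Barc n D -> D I = 0%N.
  move=> /mem_Barc DP; apply/eqP; rewrite mset_eq0; apply: contra IN => /DP[].
  by move=> -> ->.
by rewrite !out.
Qed.

Lemma juggling_map_magic (n : nat) (B : barcode) :
  Barc n B -> magic_juggling_sequence (juggling_map n B).
Proof.
move=> BP; split=> i.
  by rewrite tnth_mktuple; eexists; split; [reflexivity | rewrite sum_diff].
(* Cutting the list at [n] loses nothing: for [k >= n] the bar [throw_bar i k] ends beyond
   [n + 1]. *)
exists (mkseq (fun k => B (throw_bar i k)) n); split=> [|k].
  rewrite juggling_map_head // sumnE big_map.
  by rewrite -[X in iota _ X]subn0 big_mkord.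
rewrite juggling_mapS //; congr (_ + _%:Z).
have [kn|nk] := ltnP k n; first by rewrite nth_mkseq.
by rewrite nth_default ?size_mkseq // (Barc_throw_bar0 BP) //; lia.
Qed.



(** * Surjectivity *)

(** Throw lists have arbitrary length; this brings their sum to the form of [juggling_map_head]. *)
Lemma sumn_nth (n : nat) (s : seq nat) :
  (forall k, (n <= k)%N -> nth 0%N s k = 0%N) ->
  sumn s = (\sum_(k < n) nth 0 s k)%N.
Proof.
elim: s n => [|x s IHs] [|n] s0 /=; rewrite ?big_ord0 //.
- by rewrite big1 // => k _; rewrite nth_nil.
- rewrite (IHs 0%N) ?big_ord0 ?addn0; first exact: (s0 0%N).
  by move=> k _; exact: (s0 k.+1).
- by rewrite big_ord_recl (IHs n) // => k nk; exact: (s0 k.+1).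
Qed.

(** What sits at entry [k] of state [i] either started at entry [i + k] or was thrown at some time
    [j < i] and has since moved down [i - j - 1] places. *)
Lemma magic_entryE (n : nat) (S : n.+1.-tuple zseq) (t : 'I_n -> zseq) :
  (forall i k, tnth S (lift ord0 i) k =
     tnth S (widen_ord (leqnSn n) i) k.+1 + t i k) ->
  forall i k, tnth S i k =
    tnth S ord0 (i + k)%N + \sum_(j < n | (j < i)%N) t j (i + k - j.+1)%N.
Proof.
move=> St [i]; elim: i => [|i IHi] ilt k /=.
  by rewrite big1 // addr0; congr (tnth S _ _); exact: val_inj.
have i_n : (i < n)%N by [].
have := St (Ordinal i_n) k.
have -> : lift ord0 (Ordinal i_n) = Ordinal ilt by apply: val_inj.
have -> : widen_ord (leqnSn n) (Ordinal i_n) = Ordinal (ltnW ilt)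
  by apply: val_inj.
move=> ->; rewrite IHi /= addSnnS -addrA; congr (_ + _).
rewrite [RHS](bigD1 (Ordinal i_n)) //= addrC; congr (t _ _ + _); first by lia.
by apply: eq_bigl => j; rewrite -val_eqE /=; lia.
Qed.

(* The entry [i + k - n + 1] of the last state is a sum of throws, all
   non-negative, and [nth 0 (t i) k] is one of them. *)
Lemma magic_throw_bound (n : nat) (S : n.+1.-tuple zseq) (t : 'I_n -> seq nat) :
  (forall i k, tnth S (lift ord0 i) k =
     tnth S (widen_ord (leqnSn n) i) k.+1 + (nth 0%N (t i) k)%:Z) ->
  (forall k, (n < k)%N -> tnth S ord0 k = 0) -> tnth S ord_max = zero_state ->
  forall (i : 'I_n) k, (n <= i + k)%N -> nth 0%N (t i) k = 0%N.
Proof.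
move=> St S0 Sn i k nik.
have := magic_entryE St ord_max (i + k - n).+1.
rewrite Sn zero_stateE /= S0 ?add0r; last by lia.
under eq_bigl do rewrite ltn_ord.
rewrite -(big_morph Posz PoszD (erefl 0)) => -[/esym/eqP].
rewrite sum_nat_eq0 => /forallP/(_ i) /eqP.
by move=> /= e; rewrite -[RHS]e; congr nth; lia.
Qed.

Lemma juggling_map_surj (n : nat) :
  set_surj (Barc n) (@JSle n.+1 zero_state n) (juggling_map n).
Proof.
move=> S [[_ /fin_all_exists[t tP]] [l S0] Sn].
have St (i : 'I_n) k := (tP i).2 k.
have t0 := magic_throw_bound St.
have {}t0 (i : 'I_n) k : (n <= i + k)%N -> nth 0%N (t i) k = 0%N.
  by apply: t0 => // j nj; rewrite S0 /pad nth_default // size_tuple.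
(* Extends the throws by 0 to all times in [nat], so that they can be evaluated at the endpoints of
   any bar. *)
pose u (i k : nat) := nth 0%N (oapp t [::] (insub i)) k.
have uE (i : 'I_n) k : u i k = nth 0%N (t i) k by rewrite /u valK.
(* Supported on the [throw_bar i k] with [i, k < n]; the value at [a, b) inverts [throw_bar] by i =
   a - 1 and k = b - a - 1. *)
pose B : barcode := [fsfun[seq_mset_key] I in
  [fset throw_bar p.1 p.2 | p in [seq (i, k) | i <- iota 0 n, k <- iota 0 n]]%fset =>
  u (absz (bounds I).1).-1 (absz ((bounds I).2 - (bounds I).1)).-1].
have BE (i : 'I_n) k : B (throw_bar i k) = nth 0%N (t i) k.
  rewrite fsfunE; case: ifPn => [_|/imfsetP/= ikN].
    by rewrite -uE /=; congr u; lia.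
  (* Outside the support [i + k >= n], where throws vanish. *)
  rewrite t0 // leqNgt; apply/negP => ikn; apply: ikN; exists (val i, k) => //.
  by apply/allpairsP; exists (val i, k); rewrite !mem_iota /=;
     split=> //; have := ltn_ord i; lia.
have BP : Barc n B.
  apply/mem_Barc => I; rewrite -mset_neq0 => BI0.
  have : B I != 0%N by [].
  rewrite fsfunE; case: ifP => // /imfsetP[[i k]] /=.
  move=> /allpairsP[[i' k'] /= [+ _ [-> ->]]] IE _; rewrite mem_iota => /= i_n.
  move: BI0; rewrite IE (BE (Ordinal i_n)) => tik.
  (* A nonzero throw has [i' + k' < n], so its bar ends at [i' + k' + 2 <= n + 1]. *)
  have : ~~ (n <= i' + k')%N.
    by apply: contra tik => /(t0 (Ordinal i_n)) ->.
  by rewrite -ltnNge /= !lez_nat.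
exists B => //.
(* Backward induction, with [m] the number of transitions left before the zero state. *)
have entry m : forall i : 'I_n.+1, (i + m = n)%N ->
    tnth (juggling_map n B) i = tnth S i.
  elim: m => [|m IHm] i im.
    have -> : i = ord_max by apply: val_inj; rewrite /=; lia.
    by rewrite juggling_map_last.
  have i_n : (i < n)%N by lia.
  have -> : i = widen_ord (leqnSn n) (Ordinal i_n) by apply: val_inj.
  set j := Ordinal i_n.
  have IHj : tnth (juggling_map n B) (lift ord0 j) = tnth S (lift ord0 j).
    by apply: IHm; rewrite lift0 /=; lia.
  (* Past the head, cancelling the common throw gives the entry; the head is the sum of the
     throws. *)
  apply: funext => -[|k]; last first.
    by have := juggling_mapS j k BP; rewrite IHj St BE => /addIr.
  rewrite juggling_map_head // -(tP j).1 (@sumn_nth n) => [|k /= nk].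
    by congr _%:Z; apply: eq_bigr.
  by apply: t0; lia.
apply: eq_from_tnth => i; apply: (entry (n - i)%N).
by have := ltn_ord i; lia.
Qed.

(** * The initial state and the two bijections *)

Lemma juggling_map_start (n : nat) (B : barcode) : Barc n B ->
  tnth (juggling_map n B) ord0 = pad (diff (betti n B)).
Proof. by move=> BP; rewrite tnth_mktuple /= (trunc0 BP). Qed.

Theorem theoremB (n : nat) (hn : (1 <= n)%N) :
  set_bij (Barc n) (@JSle n.+1 zero_state n) (juggling_map n) /\
  (forall beta : betti_curve n,
     set_bij (BarcB beta) (@JS (pad (diff beta)) zero_state n) (juggling_map n)).
Proof.
split=> [|beta]; split.
- move=> B BP; split; first exact: juggling_map_magic.
  + by exists (diff (betti n B)); exact: juggling_map_start.
  + exact: juggling_map_last.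
- exact: juggling_map_inj.
- exact: juggling_map_surj.
- move=> B [BP Bbeta]; split; first exact: juggling_map_magic.
  + by rewrite juggling_map_start // Bbeta.
  + exact: juggling_map_last.
- move=> B C; rewrite !inE => -[BP _] [CP _].
  by apply: juggling_map_inj; rewrite inE.
- move=> S [Sm S0 Sn].
  (* [diff beta] has [n + 1] entries, so its padding is an admissible start for [JSle]. *)
  have [//|B BP BS] := @juggling_map_surj n S.
    by split=> //; exists (diff beta).
  exists B => //; split=> //.
  (* The initial state determines the Betti curve. *)
  by apply/diff_inj/pad_inj; rewrite -juggling_map_start // BS.
Qed.
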